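(* Let $V$ be a finite-dimensional real normed space and let $X$ be an arbitrary bounded metric space. Suppose there exists a sequence of positive numbers $(\varepsilon_n)_{n\in\mathbb{N}}$ converging to $0$ such that for every $n$ there exists a mapping $f_n\colon X\to V$ with $\operatorname{dis}(f_n)\leqslant\varepsilon_n$. Then the completion $\tilde{X}$ of $X$ is compact, and both $X$ and $\tilde{X}$ can be isometrically embedded into $V$.
   Context: For points $x,x'$ of a metric space $X$, $|xx'|$ denotes the distance between them. A normed space is regarded as a metric space with the metric induced by its norm. For a (not necessarily continuous) mapping $f\colon X\to V$ from a metric space $X$ to a normed space $V$, its distortion is $\operatorname{dis}(f)=\sup\bigl\{\bigl||xx'|-\|f(x)-f(x')\|\bigr| : x,x'\in X\bigr\}$. An isometric embedding is a distance-preserving (not necessarily surjective) map. *)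

(* Defs.v *)
From HB Require Import structures.
From mathcomp Require Import all_boot all_order all_algebra.
From mathcomp Require Import all_classical all_reals all_analysis.
Set Implicit Arguments.
Unset Strict Implicit.
Unset Printing Implicit Defensive.
Import Order.TTheory GRing.Theory Num.Theory.
Import numFieldNormedType.Exports.
Local Open Scope classical_set_scope.
Local Open Scope ring_scope.

(* MathComp-Analysis has no structure joining normedModType and vectType;
   Vector.axiom n V is the type of linear bijections V -> 'rV[R]_n. *)
Definition finite_dimensional (R : realType) (V : normedModType R) : Prop :=
  exists n : nat, inhabited (Vector.axiom n V).

Definition bounded_space (R : realType) (X : metricType R) : Prop :=
  exists M : R, forall x y : X, mdist x y <= M.

(* Normed modules are not canonically metric spaces in the library, so
   distances are passed explicitly. *)
Definition normdist (R : realType) (V : normedModType R) (u v : V) : R :=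
  `|u - v|.

Definition isometric_embedding (R : realType) (S T : Type)
    (dS : S -> S -> R) (dT : T -> T -> R) (f : S -> T) : Prop :=
  forall x y : S, dT (f x) (f y) = dS x y.

(* The supremum is taken in the extended reals: a map of unbounded distortion
   has distortion +oo, and the real-valued sup would return 0 there. *)
Definition dis (R : realType) (X : metricType R) (V : normedModType R)
    (f : X -> V) : \bar R :=
  ereal_sup [set (`| mdist p.1 p.2 - normdist (f p.1) (f p.2) |)%:E
            | p in [set: X * X]].

(* The library's completeType only covers pointed spaces; this is its defining
   condition without the base point, so that the empty space is complete. *)
Definition complete_space (R : realType) (T : metricType R) : Prop :=
  forall F : set_system T, ProperFilter F -> cauchy F ->
    exists l : T, F --> l.

Definition is_completion (R : realType) (X Xt : metricType R)
    (i : X -> Xt) : Prop :=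
  [/\ isometric_embedding mdist mdist i, dense (range i) & complete_space Xt].

(* Main.v *)
(* Fix an ultrafilter U on nat containing the cofinite sets.  Translated so as
   to vanish at a base point x0, the maps f_n send each x into a fixed closed
   ball of V for large n.  That ball is compact, so g x := lim_U (f_n x - f_n x0)
   exists for every x at once, without separability or a diagonal argument, and
   |g x - g y| = lim_U |f_n x - f_n y| = |xy|.  The completion inherits the
   hypotheses from its dense isometric copy of X, with 3 eps_n in place of
   eps_n, hence also embeds; it is compact because its image under the embedding
   lies in a compact ball, so that every ultrafilter on it is Cauchy. *)
Require Import Defs.
From HB Require Import structures.
From mathcomp Require Import all_boot all_order all_algebra.
From mathcomp Require Import all_classical all_reals all_analysis.
From mathcomp Require Import lra.
Import Order.TTheory GRing.Theory Num.Theory.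
Import numFieldNormedType.Exports.
Local Open Scope classical_set_scope.
Local Open Scope ring_scope.

(** Pushing forward along [f] lets the ultrafilter criterion for compactness in V act on
    ultrafilters living on [nat] or on X. *)
Lemma fmap_ultra (S T : Type) (f : S -> T) (F : set_system S) :
  UltraFilter F -> UltraFilter (f @ F).
Proof.
move=> FU; split=> [|G GF fFG]; first exact: fmap_proper_filter.
apply/seteqP; split=> // A GA.
have [//|FnA] := in_ultra_setVsetC (f @^-1` A) FU.
have GnA : G (~` A) by apply: fFG.
by have [x []] := filter_ex (filterI GA GnA).
Qed.

Lemma linear_rV_continuous (R : realType) (V : normedModType R) (n : nat)
    (psi : {linear 'rV[R]_n -> V}) : continuous psi.
Proof.
have -> : (psi : _ -> V) =
    fun r => \sum_(i < n) r ord0 i *: psi (delta_mx 0 i).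
  apply/funext => r; rewrite [in LHS](row_sum_delta r) linear_sum.
  by apply: eq_bigr => i _; rewrite linearZ.
apply: continuous_big => [|i _ r]; first exact: add_continuous.
have cr : (x : 'rV[R]_n) ord0 i @[x --> r] --> (r : 'rV[R]_n) ord0 i.
  exact: coord_continuous.
exact: (cvgZ cr (cvg_cst _)).
Qed.

(** The unit sphere of ['rV[R]_n] is compact, so [|psi r|] attains a minimum there, positive by
    injectivity; homogeneity extends the bound to every [r]. *)
Lemma linear_rV_inj_bounded_below (R : realType) (V : normedModType R)
    (n : nat) (psi : {linear 'rV[R]_n -> V}) : injective psi ->
  exists2 c : R, 0 < c & forall r, c * `|r| <= `|psi r|.
Proof.
move=> psi_inj; pose S := [set r : 'rV[R]_n | `|r| = 1].
have Sgt0 r : S r -> 0 < `|psi r|.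
  move=> r1; rewrite normr_gt0; apply/eqP => psir0.
  have r0 : r = 0 by apply: psi_inj; rewrite psir0 linear0.
  by move: r1; rewrite /S /= r0 normr0 => /esym/eqP; rewrite oner_eq0.
have cpsi : continuous (fun r => `|psi r|).
  by move=> r; exact: cvg_norm (linear_rV_continuous _ _ _ psi r).
have Scompact : compact S.
  apply: bounded_closed_compact.
    by exists 1; split=> // x x1 r /= r1; rewrite r1 ltW.
  have -> : S = Num.norm @^-1` [set 1 : R] by [].
  apply: closed_comp; last exact: closed_eq.
  by move=> r _; exact: norm_continuous.
have [c c_gt0 cS] : exists2 c : R, 0 < c & forall r, S r -> c <= `|psi r|.
  (* For n = 0 the sphere is empty and any positive constant serves. *)
  have [S0|/set0P/negP/negPn/eqP S0] := pselect (S !=set0); last first.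
    by exists 1 => // r; rewrite S0.
  have [s /set_mem Ss smin] := compact_EVT_min S0 Scompact
    (continuous_subspaceT cpsi).
  by exists `|psi s| => [|r Sr]; [exact: Sgt0|apply: smin; exact/mem_set].
exists c => // r; have [->|r0] := eqVneq r 0; first by rewrite normr0 mulr0.
have nr0 : 0 < `|r| by rewrite normr_gt0.
rewrite -ler_pdivlMr// mulrC.
have := cS (`|r|^-1 *: r); rewrite linearZ !normrZ !normfV !normr_id; apply.
by rewrite /S /= normrZ normfV normr_id mulVf// gt_eqF.
Qed.

(** In coordinates the ball becomes [K], closed by continuity of [psi] and bounded by the lower
    bound [c]; Heine-Borel applies to [K], and [psi] carries compactness back to V. *)
Lemma findim_ball_compact (R : realType) (V : normedModType R) (M : R) :
  finite_dimensional V -> compact [set v : V | `|v| <= M].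
Proof.
case=> n [[phi phi_lin [psi phiK psiK]]].
pose phiL : {linear V -> 'rV[R]_n} :=
  HB.pack phi (GRing.isLinear.Build _ _ _ _ phi phi_lin).
have psi_lin : linear psi by exact: (can2_linear (f := phiL)).
pose psiL : {linear 'rV[R]_n -> V} :=
  HB.pack psi (GRing.isLinear.Build _ _ _ _ psi psi_lin).
have [c c_gt0 cP] : exists2 c : R, 0 < c & forall r, c * `|r| <= `|psi r|.
  by apply: (@linear_rV_inj_bounded_below _ _ _ psiL); exact: can_inj psiK.
have psi_cont : continuous psi := @linear_rV_continuous _ _ _ psiL.
pose K := [set r : 'rV[R]_n | `|psi r| <= M].
suff -> : [set v : V | `|v| <= M] = psi @` K.
  apply: continuous_compact; first exact: continuous_subspaceT.
  apply: bounded_closed_compact.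
    exists (M / c); split=> [|x Mx r Kr]; first exact: num_real.
    apply: le_trans (ltW Mx); rewrite ler_pdivlMr// mulrC.
    exact: le_trans (cP r) Kr.
  have -> : K = (fun r => `|psi r|) @^-1` [set x | x <= M] by [].
  apply: closed_comp; last exact: closed_le.
  by move=> r _; exact: cvg_norm (psi_cont r).
apply/seteqP; split=> [v vM|_ [r Kr <-]//].
by exists (phi v); rewrite /K /= ?phiK.
Qed.

Lemma approx_isometric_embedding (R : realType) (V : normedModType R)
    (X : metricType R) (eps : nat -> R) :
  finite_dimensional V -> bounded_space X -> eps n @[n --> \oo] --> 0 ->
  (forall n, exists f : X -> V, forall x y,
     `|mdist x y - normdist (f x) (f y)| <= eps n) ->
  exists g : X -> V, isometric_embedding mdist (@normdist R V) g.
Proof.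
move=> finV [M MP] eps0 /choice[f fP].
have [[x0]|X0] := pselect (inhabited X); last first.
  by exists (fun=> 0) => x; exfalso; apply: X0.
have [U [UU leU]] := @ultraFilterLemma _ (\oo : set_system nat) _.
have epsU : eps n @[n --> U] --> 0 by exact: cvg_trans (cvg_app _ leU) eps0.
have /choice[g gP] x : exists v : V, f n x - f n x0 @[n --> U] --> v.
  (* Once [eps n < 1], the norm of [f n x - f n x0] is at most [mdist x x0 + eps n], hence at most
     [M + 1]. *)
  have := findim_ball_compact _ _ (M + 1) finV.
  rewrite compact_ultra => /(_ _ (fmap_ultra _ _ (fun n => f n x - f n x0) _ UU)).
  case=> [|v [_ ?]]; last by exists v.
  have eps1 : \forall n \near U, eps n < 1 by exact: cvgr_lt _ epsU 1 ltr01.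
  apply: filterS eps1 => n eps1 /=.
  have := fP n x x0; rewrite distrC ler_distl => /andP[_ /le_trans]; apply.
  exact: lerD (MP _ _) (ltW eps1).
exists g => x y; rewrite /normdist.
have cg : `|f n x - f n y| @[n --> U] --> `|g x - g y|.
  under eq_cvg => n do rewrite -(subrKA (f n x0)) -(opprB (f n y)).
  exact: cvg_norm (cvgB (gP x) (gP y)).
have cd : `|f n x - f n y| @[n --> U] --> mdist x y.
  apply/cvgrPdist_le => e e0.
  have epse : \forall n \near U, eps n <= e by exact: cvgr_le _ epsU e e0.
  by apply: filterS epse => n; apply: le_trans; exact: fP.
exact: (cvg_unique _ cg cd).
Qed.

Lemma dis_leP (R : realType) (X : metricType R) (V : normedModType R)
    (f : X -> V) (e : R) : (dis f <= e%:E)%E ->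
  forall x y, `|mdist x y - normdist (f x) (f y)| <= e.
Proof.
move=> fe x y; rewrite -lee_fin; apply: le_trans fe.
by apply: ereal_sup_ubound; exists (x, y).
Qed.

Lemma mdist_quadrilateral (R : realType) (X : metricType R) (x y x' y' : X) :
  `|mdist x y - mdist x' y'| <= mdist x x' + mdist y y'.
Proof.
rewrite ler_distl lerBlDr; apply/andP; split.
  have := metric_triangle x' x y'; have := metric_triangle x y y'.
  by rewrite (metric_sym x' x); lra.
have := metric_triangle x x' y; have := metric_triangle x' y' y.
by rewrite (metric_sym y' y); lra.
Qed.

(** Density gives an approximant to each point; [j] is an arbitrary choice of these, which suffices
    because approximating maps may be discontinuous. *)
Lemma completion_near (R : realType) (X Xt : metricType R) (i : X -> Xt)
    (e : R) : is_completion i -> 0 < e ->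
  exists j : Xt -> X, forall y, mdist y (i (j y)) < e.
Proof.
case=> _ di _ e0; suff /choice[j jP] : forall y, exists x, mdist y (i x) < e by exists j.
move=> y; have y_in : (ball y e)^° !=set0 by exists y; exact: nbhsx_ballx.
have [z [bz [x _ xz]]] := di _ y_in (open_interior _).
by exists x; rewrite xz; have := interior_subset bz; rewrite ballEmdist.
Qed.

Lemma completion_bounded (R : realType) (X Xt : metricType R) (i : X -> Xt) :
  is_completion i -> bounded_space X -> bounded_space Xt.
Proof.
move=> ci [M MP]; have [j jP] := completion_near _ _ _ _ 1 ci ltr01.
(* Replacing [x] and [y] by points of X at distance less than 1 costs less than 2. *)
case: ci => iso _ _; exists (M + 2) => x y.
have := mdist_quadrilateral _ _ x y (i (j x)) (i (j y)).
rewrite iso => /(le_trans (ler_norm _)).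
by have := jP x; have := jP y; have := MP (j x) (j y); lra.
Qed.

(** Of the [3 * e], one [e] is the error of [f] and the other two come from moving each endpoint
    into X. *)
Lemma completion_approx (R : realType) (V : normedModType R)
    (X Xt : metricType R) (i : X -> Xt) (f : X -> V) (e : R) :
  is_completion i -> 0 < e ->
  (forall x y, `|mdist x y - normdist (f x) (f y)| <= e) ->
  exists ft : Xt -> V, forall x y,
    `|mdist x y - normdist (ft x) (ft y)| <= 3 * e.
Proof.
move=> ci e0 fe; have [j jP] := completion_near _ _ _ _ e ci e0.
case: ci => iso _ _; exists (f \o j) => x y /=.
have := mdist_quadrilateral _ _ x y (i (j x)) (i (j y)).
rewrite iso => h; apply: le_trans (ler_distD (mdist (j x) (j y)) _ _) _.
by have := jP x; have := jP y; have := fe (j x) (j y); lra.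
Qed.

Lemma complete_isometric_compact (R : realType) (V : normedModType R)
    (X : metricType R) (g : X -> V) :
  finite_dimensional V -> bounded_space X -> complete_space X ->
  isometric_embedding mdist (@normdist R V) g -> compact [set: X].
Proof.
move=> finV [M MP] cX iso; rewrite compact_ultra => F FU _ /=.
(* Properness of [F] supplies the base point. *)
have [x0 _] := filter_ex (@filterT _ F _).
have gM : F [set x | normdist (g x) (g x0) <= M].
  by apply: filterE => x; rewrite /= iso.
have := findim_ball_compact _ _ M finV.
rewrite compact_ultra => /(_ _ (fmap_ultra _ _ (fun x => g x - g x0) _ FU) gM).
case=> v [_ gv].
suff /cX[l Fl] : cauchy F by exists l.
(* It suffices that [F] contain some ball of each radius [e]: any [x] whose translated image is
   within [e / 2] of [v] can be its centre, since [g] preserves distances. *)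
apply/cauchy_exP => e e0.
have e20 : 0 < e / 2 by rewrite divr_gt0.
have near_v : F [set x | `|v - (g x - g x0)| < e / 2].
  exact: (cvgr_dist_lt _ _ gv _ e20).
have [x xv] := filter_ex near_v; exists x.
apply: filterS near_v => y yv; rewrite ballEmdist /= -iso /normdist.
rewrite [e]splitr (_ : _ - _ = (g x - g x0 - v) + (v - (g y - g x0))).
  apply: le_lt_trans (ler_normD _ _) _; apply: ltrD; last exact: yv.
  rewrite distrC; exact: xv.
by rewrite subrKA opprB subrKA.
Qed.

Theorem theorem7 (R : realType) (V : normedModType R) (X : metricType R)
    (finV : finite_dimensional V) (bndX : bounded_space X)
    (eps : nat -> R) (eps_gt0 : forall n, 0 < eps n)
    (eps_cvg0 : eps n @[n --> \oo] --> 0)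
    (approx : forall n, exists f : X -> V, (dis f <= (eps n)%:E)%E) :
  (forall (Xt : metricType R) (i : X -> Xt), is_completion i ->
     compact [set: Xt] /\
     exists g : Xt -> V, isometric_embedding mdist (@normdist R V) g) /\
  (exists g : X -> V, isometric_embedding mdist (@normdist R V) g).
Proof.
have approxX n : exists f : X -> V, forall x y,
    `|mdist x y - normdist (f x) (f y)| <= eps n.
  by have [f fe] := approx n; exists f; exact: dis_leP.
split; last exact: approx_isometric_embedding finV bndX eps_cvg0 approxX.
move=> Xt i ci; have bndXt := completion_bounded _ _ _ _ ci bndX.
have [g iso_g] : exists g : Xt -> V, isometric_embedding mdist (@normdist R V) g.
  apply: (@approx_isometric_embedding _ _ _ (fun n => 3 * eps n)) => //.
    by rewrite -[0](mulr0 3); exact: cvgMr.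
  move=> n; have [f fe] := approxX n.
  (* [eps n] also serves as the radius of approximation by points of X, so its positivity matters
     here. *)
  exact: completion_approx ci (eps_gt0 n) fe.
split; last by exists g.
by case: (ci) => _ _ cXt; exact: complete_isometric_compact finV bndXt cXt iso_g.
Qed.
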